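(* Consider the cutting-plane algorithm which, in every round $t$, queries the center of a John ellipsoid of the current knowledge set $K_t$. For every $T$, every hidden point $w^*\in\mathsf{B}$ and every (strong) separation oracle, this algorithm incurs regret at most $\exp(O(d\log d))$, where the implied constant is absolute (in particular the bound does not depend on $T$).
   Context: $\mathsf{B}=\{w\in\mathbb{R}^d:\|w\|_2\le 1\}$. Cutting-plane problem: there is a hidden $w^*\in\mathsf{B}$. In each round $t=1,\dots,T$ the learner queries a point $p_t$, and a (strong) separation oracle returns a unit vector $v_t$, chosen adversarially and possibly depending on $p_t$ and on the history, such that $\langle w^*,v_t\rangle\ge\langle p_t,v_t\rangle$. The regret is $\sum_{t=1}^T\langle w^*-p_t,v_t\rangle$. The knowledge set is $K_1=\mathsf{B}$ and $K_{t+1}=K_t\cap\{w:\langle w-p_t,v_t\rangle\ge 0\}$. A John ellipsoid of a convex set $K$ is a set $E=A^{-1}(q+\mathsf{B})$, where $q\in\mathbb{R}^d$ and $A$ is an invertible linear map with $q+\mathsf{B}\subseteq A(K)\subseteq q+d\mathsf{B}$; its center is $A^{-1}q$. *)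

(* Defs.v *)
From HB Require Import structures.
From mathcomp Require Import all_boot all_order all_algebra.
From mathcomp Require Import reals Rstruct.
From mathcomp.analysis Require Import sequences exp.
Set Implicit Arguments. Unset Strict Implicit. Unset Printing Implicit Defensive.
Import Order.TTheory GRing.Theory Num.Theory.
Local Open Scope ring_scope.

Notation R := Rdefinitions.R.
Notation vec d := 'rV[R]_d.

Definition dot {d : nat} (u v : vec d) : R := \sum_(i < d) u 0 i * v 0 i.

Definition unit_ball (d : nat) : vec d -> Prop := fun w => dot w w <= 1.

(* Knowledge sets: K_1 = B and K_{t+1} = K_t ∩ {w : <w - p_t, v_t> >= 0}.
   Rounds are indexed from 0 here: knowledge d p v t is K_{t+1} of the paper. *)
Fixpoint knowledge (d : nat) (p v : nat -> vec d) (t : nat) : vec d -> Prop :=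
  match t with
  | O => @unit_ball d
  | S t' => fun w => knowledge p v t' w /\ 0 <= dot (w - p t') (v t')
  end.

(* E = A^{-1}(q + B) is a John ellipsoid of K: A invertible linear map
   (acting on row vectors x |-> x *m A), q + B ⊆ A(K) ⊆ q + dB. *)
Definition john_ellipsoid (d : nat) (K : vec d -> Prop) (A : 'M[R]_d) (q : vec d)
  : Prop :=
  A \in unitmx /\
  (forall y : vec d, dot (y - q) (y - q) <= 1 -> exists x, K x /\ y = x *m A) /\
  (forall x : vec d, K x -> dot (x *m A - q) (x *m A - q) <= (d%:R) ^+ 2).

Definition john_center (d : nat) (K : vec d -> Prop) (c : vec d) : Prop :=
  exists (A : 'M[R]_d) (q : vec d), john_ellipsoid K A q /\ c = q *m invmx A.

Definition regret (d : nat) (wstar : vec d) (p v : nat -> vec d) (T : nat) : R :=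
  \sum_(t < T) dot (wstar - p t) (v t).

(* Main.v *)
Require Import Defs.
From HB Require Import structures.
From mathcomp Require Import all_boot all_order all_algebra.
From mathcomp Require Import boolp reals Rstruct.
From mathcomp.analysis Require Import sequences exp.
From mathcomp Require Import zify ring lra.
Import Order.TTheory GRing.Theory Num.Theory.
Local Open Scope ring_scope.

(* For each [i], the number of rounds with gap [<w* - p_t, v_t> >= 2^-i] is at most
   [exp (O (d ln d + 1)) * (d + i)]; summing [2^(1-i)] times these bounds over dyadic
   scales gives the result.  To bound one such number, count the cells of a cubic
   grid of mesh [2^-i / (4 d^2)] that meet [K_t], a discrete volume of [K_t].  Let
   [x] in [K_t] maximise [<., v_t>] among finitely many representatives and [w*].
   The map [w |-> p_t + ((w - p_t) - 3 (x - p_t)) / (4 d)] sends [K_t] into the John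
   ellipsoid, hence into [K_t], so deep below the cut that the cells it reaches do
   not meet [K_{t+1}].  It contracts by [4 d] only, so at most [(4 d + 1)^d] cells
   have the same image, and a fraction at least [(4 d + 1)^-d] of the cells is lost.
   As [w*] always survives, the logarithm of the number of cells stays nonnegative. *)

(** * Inner products and the Euclidean unit ball *)

Lemma dot_combination {d : nat} (a b : R) (x y v : vec d) :
  dot (a *: x + b *: y) v = a * dot x v + b * dot y v.
Proof.
rewrite /dot !big_distrr -big_split /=; apply: eq_bigr => i _.
by rewrite !mxE; ring.
Qed.

Lemma dotBl {d : nat} (x y v : vec d) : dot (x - y) v = dot x v - dot y v.
Proof.
have -> : x - y = 1 *: x + -1 *: y by rewrite scale1r scaleN1r.
by rewrite dot_combination mul1r mulN1r.
Qed.

Lemma sqr_coord_le_dot {d : nat} (v : vec d) (i : 'I_d) : v 0 i ^+ 2 <= dot v v.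
Proof.
rewrite /dot (bigD1 i) //= -expr2 lerDl sumr_ge0 // => j _.
by rewrite -expr2 sqr_ge0.
Qed.

Lemma norm_coord_le1 {d : nat} (v : vec d) (i : 'I_d) : dot v v <= 1 -> `|v 0 i| <= 1.
Proof.
move=> v1; rewrite -(@ler_pXn2r _ 2) ?nnegrE // expr1n real_normK ?num_real //.
exact: le_trans (sqr_coord_le_dot v i) v1.
Qed.

(** Convexity of the squared norm at [b] and [- a], with weights [1/4] and [3/4]; the defect is
    [3/16] of the squared norm of [a + b]. *)
Lemma dot_convex {d : nat} (a b : vec d) (r : R) :
  dot a a <= r -> dot b b <= r ->
  dot (4^-1 *: b - (3 / 4) *: a) (4^-1 *: b - (3 / 4) *: a) <= r.
Proof.
move=> ar br.
have : dot (4^-1 *: b - (3 / 4) *: a) (4^-1 *: b - (3 / 4) *: a)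
    <= 4^-1 * dot b b + 3 / 4 * dot a a.
  rewrite /dot !big_distrr -big_split /=; apply: ler_sum => i _.
  rewrite !mxE; have := sqr_ge0 (a 0 i + b 0 i); nra.
lra.
Qed.

Lemma norm_dot_unit_ball_le1 {d : nat} (w v : vec d) :
  unit_ball w -> dot v v = 1 -> `|dot w v| <= 1.
Proof.
rewrite /unit_ball => w1 v1.
have wv (s : R) : s ^+ 2 = 1 -> 0 <= dot w w + 2 * s * dot w v + dot v v.
  move=> s1; rewrite /dot big_distrr -!big_split /=; apply: sumr_ge0 => i _.
  have := sqr_ge0 (w 0 i + s * v 0 i).
  have -> : v 0 i * v 0 i = s ^+ 2 * (v 0 i * v 0 i) by rewrite s1 mul1r.
  nra.
have := wv 1 (expr1n _ _); have := wv (-1) ltac:(by rewrite sqrrN expr1n).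
by rewrite ler_norml; lra.
Qed.

(** * Contraction into a John ellipsoid *)

Section JohnCenter.
Context {d : nat} {K : vec d -> Prop} {c : vec d}.
Hypothesis d_gt0 : (0 < d)%N.
Hypothesis cK : john_center K c.

Lemma john_center_in : K c.
Proof.
case: cK => A [q [[uA [inE _]] ->]].
have [|x [Kx qE]] := inE q; first by rewrite subrr /dot big1 // => i _; rewrite mxE mul0r.
by rewrite qE mulmxK.
Qed.

(* Points of [K] shrunk by [1/d] towards the center, or reflected through it,
   lie in the ellipsoid; the combination below is a convex one of these. *)
Lemma john_center_shrink (x w : vec d) :
  K x -> K w -> K (c + (4 * d%:R)^-1 *: ((w - c) - 3 *: (x - c))).
Proof.
have dR : (0 : R) < d%:R by rewrite ltr0n.
case: cK => A [q [[uA [inE outE]] ->]] Kx Kw; set z := (X in K X).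
have zA : z *m A - q = d%:R^-1 *: (4^-1 *: (w *m A - q) - (3 / 4) *: (x *m A - q)).
  rewrite /z mulmxDl mulmxKV // addrAC subrr add0r -scalemxAl mulmxBl -scalemxAl.
  rewrite !mulmxBl !mulmxKV //; apply/rowP => i; rewrite !mxE; field.
  by rewrite gt_eqF.
have [|y [Ky]] := inE (z *m A); last first.
  by move/(congr1 (mulmx^~ (invmx A))); rewrite !mulmxK // => ->.
have := dot_convex _ _ _ (outE _ Kx) (outE _ Kw); rewrite {}zA.
set u := 4^-1 *: _ - _ => u_le.
have -> : dot (d%:R^-1 *: u) (d%:R^-1 *: u) = dot u u / d%:R ^+ 2.
  rewrite /dot big_distrl /=; apply: eq_bigr => i _; rewrite !mxE; field.
  by rewrite gt_eqF.
by rewrite ler_pdivrMr ?exprn_gt0 // mul1r.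
Qed.

End JohnCenter.

(** * Grid cells as a discrete volume *)

(* The index of the cell containing [w] in the grid of mesh [2 / Q] on [[-1, 1]^d]. *)
Definition cell {d : nat} (Q : nat) (w : vec d) : {ffun 'I_d -> 'I_Q.+1} :=
  [ffun i => inord (Num.truncn ((w 0 i + 1) * (Q%:R / 2)))].

Definition hit_cells {d : nat} (Q : nat) (K : vec d -> Prop) : {set {ffun 'I_d -> 'I_Q.+1}} :=
  [set n | `[< exists w, K w /\ cell Q w = n >]].

Lemma hit_cellsP {d Q : nat} (K : vec d -> Prop) n :
  reflect (exists w, K w /\ cell Q w = n) (n \in hit_cells Q K).
Proof. by rewrite inE; exact: asboolP. Qed.

Lemma mem_hit_cells {d Q : nat} (K : vec d -> Prop) w :
  K w -> cell Q w \in hit_cells Q K.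
Proof. by move=> Kw; apply/hit_cellsP; exists w. Qed.

Lemma hit_cells_sub {d Q : nat} (K K' : vec d -> Prop) :
  (forall w, K' w -> K w) -> hit_cells Q K' \subset hit_cells Q K.
Proof.
move=> sub; apply/subsetP => n /hit_cellsP[w [/sub Kw <-]].
exact: mem_hit_cells.
Qed.

Lemma cell_bounds {d Q : nat} {w : vec d} (i : 'I_d) : unit_ball w ->
  (cell Q w i)%:R <= (w 0 i + 1) * (Q%:R / 2) < (cell Q w i)%:R + 1.
Proof.
move=> /(norm_coord_le1 w i); rewrite ler_norml => /andP[wl wu].
have Q0 : (0 : R) <= Q%:R by [].
have w0 : 0 <= (w 0 i + 1) * (Q%:R / 2) by apply: mulr_ge0; lra.
rewrite ffunE inordK; first by rewrite natr1; exact: truncn_itv.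
(* A coordinate equal to 1 has index [Q], hence [Q.+1] indices per axis. *)
rewrite truncn_lt_nat // -[Q.+1%:R]natr1; nra.
Qed.

(** Within a fibre coordinates differ by at most [k], so residues modulo [k.+1] tell its points
    apart: pairing them with [f] is injective on [S]. *)
Lemma card_bounded_fibres {d Q k : nat} (S : {set {ffun 'I_d -> 'I_Q.+1}})
    (f : {ffun 'I_d -> 'I_Q.+1} -> {ffun 'I_d -> 'I_Q.+1}) :
  {in S &, forall m n, f m = f n -> forall i, (m i <= n i + k)%N} ->
  (#|S| <= k.+1 ^ d * #|f @: S|)%N.
Proof.
move=> fibre.
pose g (n : {ffun 'I_d -> 'I_Q.+1}) : {ffun 'I_d -> 'I_k.+1} := [ffun i => inord (n i %% k.+1)].
have injfg : {in S &, injective (fun n => (g n, f n))}.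
  move=> m n mS nS [gE fE]; apply/ffunP => i; apply/val_inj => /=.
  have := congr1 (fun h : {ffun 'I_d -> 'I_k.+1} => val (h i)) gE.
  rewrite !ffunE /= !inordK ?ltn_mod // => mE.
  have := fibre _ _ mS nS fE i; have := fibre _ _ nS mS (esym fE) i.
  rewrite [m i : nat](divn_eq _ k.+1) [n i : nat](divn_eq _ k.+1) mE.
  have lt_mul a b : (a < b)%N -> (a * k.+1 + k.+1 <= b * k.+1)%N.
    by move=> ab; rewrite addnC -mulSn leq_mul2r ab orbT.
  case: (ltngtP (m i %/ k.+1) (n i %/ k.+1)) => [/lt_mul|/lt_mul|->//]; lia.
have -> : (k.+1 ^ d = #|[set: {ffun 'I_d -> 'I_k.+1}]|)%N.
  by rewrite cardsT card_ffun !card_ord.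
rewrite -(card_in_imset injfg) -cardsX subset_leq_card //.
by apply/subsetP => _ /imsetP[n nS ->]; rewrite in_setX in_setT; exact: imset_f.
Qed.

Lemma card_hit_cells_cut {d Q : nat} (K K' : vec d -> Prop) (c v x0 : vec d) (e : R) :
  (0 < d)%N -> (forall w, K w -> unit_ball w) -> john_center K c ->
  dot v v = 1 -> K x0 -> e <= dot (x0 - c) v -> 4 * d%:R ^+ 2 < e * Q%:R ->
  (forall w, K' w -> K w /\ 0 <= dot (w - c) v) ->
  (#|hit_cells Q K| <= (4 * d).+1 ^ d * (#|hit_cells Q K| - #|hit_cells Q K'|))%N.
Proof.
move=> d0 KB cK v1 Kx0 ex0 eQ K'K.
have dR : (1 : R) <= d%:R by rewrite ler1n.
have Q0 : (0 : R) < Q%:R.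
  by rewrite ltr0n lt0n; apply/eqP => Q0; move: eQ; rewrite Q0 mulr0; nra.
have d2 : (0 : R) < 2 * d%:R by lra.
(* Cells missing [K] get a default witness, so [wit n] lies in [K] for every [n]. *)
have /choice[wit witP] n :
    exists w, K w /\ (n \in hit_cells Q K -> cell Q w = n).
  by have [/hit_cellsP[w [Kw <-]]|_] := boolP (n \in hit_cells Q K); [exists w|exists x0].
have Kwit n : K (wit n) by case: (witP n).
(* The maximum is over a finite type, hence attained; [None] stands for [x0] and makes it at least
   [e]. *)
have [x [Kx ex xmax]] : exists x, [/\ K x, e <= dot (x - c) v &
    forall n, dot (wit n - c) v <= dot (x - c) v].
  pose F o := if o is Some n then wit n else x0.
  case: (@arg_maxP _ _ _ None xpredT (fun o => dot (F o - c) v)) => // o _ omax.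
  exists (F o); split; first by case: (o) => [n|]; [exact: Kwit|].
    exact: le_trans ex0 (omax None _).
  by move=> n; exact: (omax (Some n)).
pose h n := c + (4 * d%:R)^-1 *: ((wit n - c) - 3 *: (x - c)).
have Kh n : K (h n) by exact: john_center_shrink.
(* If [x] has height [M >= e] above the cut, [h n] has height at most
   [(M - 3 M) / (4 d) = - M / (2 d)]. *)
have hv n : 2 * d%:R * dot (h n - c) v <= - e.
  have -> : h n - c = (4 * d%:R)^-1 *: (wit n - c) + (- 3 / (4 * d%:R)) *: (x - c).
    by apply/rowP => j; rewrite !mxE; field; rewrite gt_eqF //; lra.
  rewrite dot_combination.
  have -> (a b : R) : 2 * d%:R * ((4 * d%:R)^-1 * a + -3 / (4 * d%:R) * b)
      = 2^-1 * (a - 3 * b) by field; rewrite gt_eqF //; lra.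
  by have := xmax n; lra.
have cell_close (y z : vec d) i : K y -> K z -> cell Q y = cell Q z ->
    `|y 0 i - z 0 i| * Q%:R < 2.
  move=> /KB By /KB Bz yz.
  have := cell_bounds i By (Q := Q); have := cell_bounds i Bz (Q := Q).
  rewrite yz => /andP[? ?] /andP[? ?].
  rewrite -[X in _ * X < _](gtr0_norm Q0) -normrM ltr_norml.
  by apply/andP; split; lra.
(* Points of [K] sharing a cell differ by at most [2 d / Q] along [v], which is less than the depth
   [e / (2 d)] of [h n]. *)
have h_removed n : cell Q (h n) \notin hit_cells Q K'.
  apply/hit_cellsP => -[w [/K'K[Kw wv] wh]].
  have : dot (w - h n) v * Q%:R <= 2 * d%:R.
    have -> : 2 * d%:R = \sum_(i < d) (2 : R).
      by rewrite sumr_const card_ord mulr_natr.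
    rewrite /dot big_distrl /=; apply: ler_sum => i _.
    have := cell_close _ _ i Kw (Kh n) wh.
    have := norm_coord_le1 v i; rewrite v1 => /(_ (lexx _)) vi wi.
    have -> : (w - h n) 0 i = w 0 i - h n 0 i by rewrite !mxE.
    apply: le_trans (ltW wi); rewrite ler_pM2r //.
    apply: le_trans (ler_norm _) _; rewrite normrM.
    by apply: ler_piMr.
  have : e <= 2 * d%:R * dot (w - h n) v.
    have := hv n; move: wv; rewrite !dotBl; nra.
  move=> /(ler_wpM2r (ltW Q0)) + /(ler_wpM2l (ltW d2)); nra.
(* If the images share a cell, the witnesses differ by less than [4 d] meshes per coordinate, and
   the integer indices by at most [4 d]. *)
have /card_bounded_fibres : {in hit_cells Q K &, forall m n,
    cell Q (h m) = cell Q (h n) -> forall i, (m i <= n i + 4 * d)%N}.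
  move=> m n mK nK mn i; have := cell_close _ _ i (Kh m) (Kh n) mn.
  have -> : h m 0 i - h n 0 i = (wit m 0 i - wit n 0 i) / (4 * d%:R).
    by rewrite !mxE; field; rewrite gt_eqF //; lra.
  rewrite normrM [`|_^-1|]gtr0_norm ?invr_gt0; last lra.
  rewrite mulrAC ltr_pdivrMr; last lra.
  move=> close.
  have := cell_bounds i (KB _ (Kwit m)) (Q := Q).
  have := cell_bounds i (KB _ (Kwit n)) (Q := Q).
  rewrite (proj2 (witP m) mK) (proj2 (witP n) nK) => /andP[? ?] /andP[? ?].
  rewrite -ltnS -(ltr_nat R) -natr1 natrD natrM.
  have := ler_norm (wit m 0 i - wit n 0 i); nra.
move=> /leq_trans; apply; rewrite leq_mul2l; apply/orP; right.
rewrite -(setIidPr (hit_cells_sub _ _ (fun w K'w => proj1 (K'K w K'w)))) -cardsD.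
apply/subset_leq_card/subsetP => _ /imsetP[n nK ->].
by rewrite inE h_removed mem_hit_cells.
Qed.

(** * Logarithmic potential and dyadic sums *)

Lemma ln_le_sub1 (x : R) : 0 < x -> ln x <= x - 1.
Proof.
by move=> x0; have := @le_ln1Dx R (x - 1) ltac:(lra); rewrite addrC subrK.
Qed.

(** A marked round multiplies [c] by at most [1 - 1/k], so [ln c] falls by at least [1/k]; these
    falls telescope. *)
Lemma count_drops (k : R) (c : nat -> R) (b : nat -> bool) (T : nat) : 0 < k ->
  (forall t, (t <= T)%N -> 0 < c t) ->
  (forall t, (t < T)%N -> c t.+1 <= c t) ->
  (forall t, (t < T)%N -> b t -> c t <= k * (c t - c t.+1)) ->
  \sum_(t < T) (b t)%:R <= k * (ln (c 0%N) - ln (c T)).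
Proof.
move=> k0; elim: T => [|T IH] c0 mono drop; first by rewrite big_ord0 subrr mulr0.
rewrite big_ord_recr /=.
have {IH} := IH (fun t tT => c0 t (leqW tT)) (fun t tT => mono t (leqW tT))
  (fun t tT => drop t (leqW tT)).
have cT := c0 T (leqnSn T); have cT1 := c0 T.+1 (leqnn _).
suff : (b T)%:R <= k * (ln (c T) - ln (c T.+1)) by lra.
have [bT|_] := boolP (b T); last first.
  apply: mulr_ge0; [exact: ltW|rewrite subr_ge0 ler_ln ?posrE //; exact: mono].
have cc : 0 < c T.+1 / c T by rewrite divr_gt0.
have := ln_le_sub1 _ cc; rewrite ln_div ?posrE // => le_ln.
have : 1 <= k * (1 - c T.+1 / c T).
  rewrite -(ler_pM2r cT) mul1r -mulrA mulrBl divfK ?gt_eqF // mul1r.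
  exact: drop.
by move=> /le_trans; apply; rewrite ler_pM2l //; lra.
Qed.

(** From [I] to [I.+1] the first term loses [2^-(I+1)]. If [x] reaches that scale, the new summand
    pays for the loss; otherwise the first term alone exceeds [x]. *)
Lemma dyadic_le (x : R) (I : nat) : x <= 2 ->
  x <= 2^-1 ^+ I + \sum_(i < I.+1) 2 * 2^-1 ^+ i * (2^-1 ^+ i <= x)%R%:R.
Proof.
move=> x2; elim: I => [|I IH].
  by rewrite big_ord_recr big_ord0 /= expr0; have [? | ?] /= := leP 1 x; lra.
rewrite big_ord_recr /=.
have e0 : (0 : R) < 2^-1 ^+ I.+1 by rewrite exprn_gt0 // invr_gt0.
have s0 : (0 : R) <= \sum_(i < I.+1) 2 * 2^-1 ^+ i * (2^-1 ^+ i <= x)%R%:R.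
  by apply: sumr_ge0 => i _; rewrite !mulr_ge0 // exprn_ge0 // invr_ge0.
have [ex|xe] /= := leP (2^-1 ^+ I.+1) x; last lra.
by rewrite exprS in ex e0 *; lra.
Qed.

Lemma sum_dyadic_affine_le (a : R) (n : nat) : 0 <= a ->
  \sum_(i < n) 2 * 2^-1 ^+ i * (a + i%:R) <= 4 * a + 4.
Proof.
(* The exact value makes the induction go through. *)
move=> a0; suff -> : \sum_(i < n) 2 * 2^-1 ^+ i * (a + i%:R)
    = 4 * a + 4 - 2 * 2^-1 ^+ n * (2 * a + 2 * n%:R + 2).
  by rewrite lerBlDr lerDl !mulr_ge0 ?exprn_ge0 ?invr_ge0 ?addr_ge0 ?mulr_ge0.
elim: n => [|n IH]; first by rewrite big_ord0 expr0; ring.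
by rewrite big_ord_recr IH /= exprS -natr1; field.
Qed.

(** * Regret of a transcript *)

Section Transcript.
Context {d T : nat} {wstar : vec d} {p v : nat -> vec d}.
Hypothesis d_gt0 : (0 < d)%N.
Hypothesis wstarB : unit_ball wstar.
Hypothesis transcript : forall t, (t < T)%N ->
  john_center (knowledge p v t) (p t) /\ dot (v t) (v t) = 1 /\
  dot (p t) (v t) <= dot wstar (v t).

Lemma knowledge_unit_ball t w : knowledge p v t w -> unit_ball w.
Proof. by elim: t => [|t IH] //= [/IH]. Qed.

Lemma knowledge_wstar t : (t <= T)%N -> knowledge p v t wstar.
Proof.
elim: t => [|t IH] //= tT; split; first exact/IH/ltnW.
by have [_ [_]] := transcript t tT; rewrite dotBl subr_ge0.
Qed.

Lemma gap_le2 t : (t < T)%N -> dot (wstar - p t) (v t) <= 2.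
Proof.
move=> tT; have [cK [v1 _]] := transcript t tT; rewrite dotBl.
have := norm_dot_unit_ball_le1 _ _ (knowledge_unit_ball t _ (john_center_in cK)) v1.
have := norm_dot_unit_ball_le1 _ _ wstarB v1.
by rewrite !ler_norml => /andP[_ ?] /andP[? _]; lra.
Qed.

Lemma count_gaps (i : nat) :
  \sum_(t < T) (2^-1 ^+ i <= dot (wstar - p t) (v t))%R%:R
    <= (4 * d%:R + 1) ^+ d * d%:R * (8 + 2 * d%:R + i%:R) :> R.
Proof.
have dR : (1 : R) <= d%:R by rewrite ler1n.
(* Twice [4 d^2 / e] for [e = 2^-i], which gives the strict inequality required by the cut. *)
pose Q := (8 * d ^ 2 * 2 ^ i)%N.
have k0 : (0 : R) < ((4 * d).+1 ^ d)%N%:R by rewrite ltr0n expn_gt0.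
have kE : ((4 * d).+1 ^ d)%N%:R = (4 * d%:R + 1) ^+ d :> R.
  by rewrite natrX -natr1 natrM.
pose c t : R := #|hit_cells Q (knowledge p v t)|%:R.
have c_ge1 t : (t <= T)%N -> 1 <= c t.
  move=> /knowledge_wstar Kw; rewrite ler1n card_gt0; apply/set0Pn.
  by exists (cell Q wstar); exact: mem_hit_cells.
have sub t : (#|hit_cells Q (knowledge p v t.+1)| <= #|hit_cells Q (knowledge p v t)|)%N.
  by apply/subset_leq_card/hit_cells_sub => w [].
have := count_drops _ c (fun t => 2^-1 ^+ i <= dot (wstar - p t) (v t)) T k0.
move=> /(_ _ _ _)/le_trans; apply.
- by move=> t /c_ge1; lra.
- by move=> t _; rewrite ler_nat.
- move=> t tT gap; have [cK [v1 _]] := transcript t tT.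
  rewrite /c -natrB // -natrM ler_nat.
  apply: (@card_hit_cells_cut d Q _ _ (p t) (v t) wstar (2^-1 ^+ i)) => //.
  + exact: knowledge_unit_ball.
  + exact/knowledge_wstar/ltnW.
  + have half : 2^-1 ^+ i * 2 ^+ i = 1 :> R by rewrite -exprMn mulVf ?expr1n ?pnatr_eq0.
    rewrite !natrM !natrX [ltRHS]mulrCA half mulr1; nra.
rewrite kE -mulrA ler_pM2l -?kE // => {k0 kE}.
have lnT : 0 <= ln (c T) by rewrite ln_ge0 // c_ge1.
suff : ln (c 0%N) <= d%:R * (8 + 2 * d%:R + i%:R) by lra.
have d20 : (0 : R) < d%:R ^+ 2 by rewrite exprn_gt0 // ltr0n.
have i20 : (0 : R) < 2 ^+ i by rewrite exprn_gt0.
have d90 : (0 : R) < 9 * d%:R ^+ 2 by exact: mulr_gt0.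
have Q0 : (0 : R) < 9 * d%:R ^+ 2 * 2 ^+ i by exact: mulr_gt0.
have c0_le : c 0%N <= (9 * d%:R ^+ 2 * 2 ^+ i) ^+ d.
  have : c 0%N <= (Q.+1 ^ d)%N%:R.
    rewrite ler_nat; apply: leq_trans (max_card _) _.
    by rewrite card_ffun !card_ord.
  move=> /le_trans; apply; rewrite natrX lerXn2r ?nnegrE //; first exact: ltW.
  have d2 : (1 : R) <= d%:R ^+ 2 by apply: exprn_ege1.
  have i2 : (1 : R) <= 2 ^+ i by apply: exprn_ege1; lra.
  rewrite -natr1 !natrM !natrX; nra.
have : ln (c 0%N) <= ln ((9 * d%:R ^+ 2 * 2 ^+ i) ^+ d).
  by rewrite ler_ln ?posrE ?exprn_gt0 //; have := c_ge1 0%N isT; lra.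
move=> /le_trans; apply; rewrite lnXn // -[leLHS]mulr_natl ler_pM2l; last lra.
rewrite 2?lnM ?posrE // !lnXn ?ltr0n //.
(* Here [ln 9 <= 8], [ln d <= d - 1] and [ln 2 <= 1]. *)
have := ln_le_sub1 9 ltac:(lra); have := ln_le_sub1 d%:R ltac:(lra); have := ln_le_sub1 2 ltac:(lra).
have : (0 : R) <= i%:R by [].
rewrite -!(mulr_natl (ln _)); nra.
Qed.

Lemma regret_le : regret wstar p v T <= 1 + 64 * d%:R ^+ 2 * (4 * d%:R + 1) ^+ d.
Proof.
have dR : (1 : R) <= d%:R by rewrite ler1n.
set k := (4 * d%:R + 1) ^+ d.
have k0 : (0 : R) <= k by rewrite exprn_ge0 //; lra.
(* Stopping at scale [2^-T] leaves [T * 2^-T <= 1] over all rounds, so the bound is free of [T]. *)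
pose B := \sum_(i < T.+1) 2 * 2^-1 ^+ i * \sum_(t < T) (2^-1 ^+ i <= dot (wstar - p t) (v t))%R%:R : R.
have : regret wstar p v T <= T%:R * 2^-1 ^+ T + B.
  rewrite /B; under [X in _ + X]eq_bigr do rewrite big_distrr.
  rewrite exchange_big /= -[T in T%:R]card_ord mulr_natl -sumr_const -big_split /=.
  apply: ler_sum => t _; exact/dyadic_le/gap_le2.
have T2 : T%:R * 2^-1 ^+ T <= 1 :> R.
  by rewrite exprVn ler_pdivrMr ?exprn_gt0 // mul1r -natrX ler_nat ltnW // ltn_expl.
suff : B <= 64 * d%:R ^+ 2 * k by lra.
have B_le : B <= k * d%:R * \sum_(i < T.+1) 2 * 2^-1 ^+ i * (8 + 2 * d%:R + i%:R).
  rewrite big_distrr /=; apply: ler_sum => i _.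
  rewrite [leRHS]mulrCA; apply: ler_wpM2l; last exact: count_gaps.
  by rewrite mulr_ge0 // exprn_ge0 // invr_ge0.
have := sum_dyadic_affine_le (8 + 2 * d%:R) T.+1 ltac:(lra).
have kd0 : 0 <= k * d%:R by rewrite mulr_ge0 //; lra.
move=> /(ler_wpM2l kd0); nra.
Qed.

End Transcript.

(** * Exponential form of the bound *)

Lemma regret_bound_le_exp (d : nat) : (0 < d)%N ->
  1 + 64 * d%:R ^+ 2 * (4 * d%:R + 1) ^+ d <= expR (100 * (d%:R * ln d%:R + 1)) :> R.
Proof.
move=> d0; have dR : (1 : R) <= d%:R by rewrite ler1n.
have x0 : (0 : R) < d%:R by lra.
have L0 : 0 <= ln (d%:R : R) by exact: ln_ge0.
have pow_ge1 : (1 : R) <= (4 * d%:R + 1) ^+ d by apply: exprn_ege1; lra.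
have : 1 + 64 * d%:R ^+ 2 * (4 * d%:R + 1) ^+ d
    <= 65 * d%:R ^+ 2 * (5 * d%:R) ^+ d :> R.
  have : (4 * d%:R + 1) ^+ d <= (5 * d%:R) ^+ d :> R.
    by rewrite lerXn2r ?nnegrE //; lra.
  have : (1 : R) <= d%:R ^+ 2 by apply: exprn_ege1.
  nra.
move=> /le_trans; apply.
have y0 : (0 : R) < 65 * d%:R ^+ 2 * (5 * d%:R) ^+ d.
  by rewrite mulr_gt0 ?mulr_gt0 ?exprn_gt0 ?mulr_gt0.
rewrite -[leLHS]lnK ?posrE // ler_expR.
have d20 : (0 : R) < d%:R ^+ 2 by rewrite exprn_gt0.
have d50 : (0 : R) < 5 * d%:R by rewrite mulr_gt0.
have d650 : (0 : R) < 65 * d%:R ^+ 2 by exact: mulr_gt0.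
rewrite 2?lnM ?posrE ?exprn_gt0 // !lnXn // lnM ?posrE //.
rewrite -!(mulr_natl (ln _)) -!(mulr_natl (_ + _)).
(* Absorbs the factor [5 ^ d] into [exp (O (d ln d + 1))]. *)
have d_le : d%:R <= 1 + d%:R * ln d%:R :> R.
  have := ln_le_sub1 d%:R^-1 ltac:(by rewrite invr_gt0); rewrite lnV ?posrE // => lnd.
  have : d%:R * (1 - d%:R^-1) <= d%:R * ln d%:R :> R by rewrite ler_pM2l //; lra.
  by rewrite mulrBr mulr1 divff ?gt_eqF //; lra.
(* With [ln 65 <= 64] and [ln 5 <= 4] the logarithm is at most [68 + 7 d ln d]. *)
have := ln_le_sub1 65 ltac:(lra); have := ln_le_sub1 5 ltac:(lra).
nra.
Qed.

(* Every transcript (p_t, v_t)_{t<T} in which each query p_t is the center of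
   some John ellipsoid of K_t and each answer v_t is a unit vector satisfying the
   (strong) separation condition <w*, v_t> >= <p_t, v_t> has regret at most
   exp(C (d ln d + 1)) for an absolute constant C. *)
Theorem theorem4p2 :
  exists C : R, 0 < C /\
  forall (d : nat), (0 < d)%N ->
  forall (T : nat) (wstar : 'rV[R]_d) (p v : nat -> 'rV[R]_d),
    unit_ball wstar ->
    (forall t, (t < T)%N ->
       john_center (knowledge p v t) (p t) /\
       dot (v t) (v t) = 1 /\
       dot (p t) (v t) <= dot wstar (v t)) ->
    regret wstar p v T <= expR (C * (d%:R * ln (d%:R) + 1)).
Proof.
exists 100; split=> // d d0 T wstar p v wB tr.
apply: (le_trans (regret_le d0 wB tr)); exact: regret_bound_le_exp.
Qed.
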